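(* Let $D_{G''}$ be the formal derivative with $D_{G''}(x)=1$, $D_{G''}(y)=1$. For any $n\ge 1$, the following identity of operators holds: $$(xyD_{G''})^n=\sum_{k=1}^n\sum_{\ell=k}^n a_{n,k,\ell}\,x^\ell y^{n+k-\ell}D_{G''}^k,$$ where the coefficients $a_{n,k,\ell}$ satisfy the recurrence relation $$a_{n+1,k,\ell}=\ell a_{n,k,\ell}+(n+k-\ell+1)a_{n,k,\ell-1}+a_{n,k-1,\ell-1},$$ with the initial conditions $a_{1,1,1}=1$ and $a_{1,k,\ell}=0$ if $(k,\ell)\neq(1,1)$. The coefficient $a_{n,k,\ell}$ counts full binary $k$-forests on $[n]$ with $\ell$ left leaves. Moreover, $$(xyD_{G''})^n=\sum_{k=1}^n\sum_{\ell=k}^{\lfloor (n+k)/2\rfloor}\gamma(n,k,\ell)(xy)^\ell(x+y)^{n+k-2\ell}D_{G''}^k,$$ where the coefficients $\gamma(n,k,\ell)$ satisfy the recursion $$\gamma(n+1,k,\ell)=\ell\gamma(n,k,\ell)+2(n+k-2\ell+2)\gamma(n,k,\ell-1)+\gamma(n,k-1,\ell-1),$$ with the initial conditions $\gamma(1,1,1)=1$ and $\gamma(1,k,\ell)=0$ for all $(k,\ell)\ne(1,1)$.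
   Context: $D_{G''}$ is the linear operator on polynomials in the commuting indeterminates $x,y$ satisfying the Leibniz rule $D_{G''}(uv)=D_{G''}(u)v+uD_{G''}(v)$ with the given values on $x,y$; $xyD_{G''}$ is the operator $f\mapsto xy\cdot D_{G''}(f)$. Coefficients are taken to be $0$ outside the summation ranges displayed. A planted full binary increasing plane tree on a finite set $S$ of $m\ge1$ positive integers is a plane tree with $m$ internal vertices, labelled bijectively by $S$, and $m+1$ unlabelled leaves, such that: (i) the root is an internal vertex carrying the smallest label; (ii) every internal vertex, including the root, has exactly two ordered children, a left child and a right child; (iii) the labels of the internal vertices along the path from the root to any internal vertex form an increasing sequence. A left leaf is a leaf that is a left child. A full binary $k$-forest on $[n]=\{1,\dots,n\}$ is a sequence of $k$ planted full binary increasing plane trees whose label sets form a partition of $[n]$, with root labels increasing from left to right. The number of left leaves of a forest is the total over its trees. *)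

(* Defs.v *)
From HB Require Import structures.
From mathcomp Require Import all_boot all_order all_algebra.
From mathcomp Require Import finmap mpoly.

Set Implicit Arguments.
Unset Strict Implicit.
Unset Printing Implicit Defensive.

Import GRing.Theory.
Local Open Scope ring_scope.

Section FormalDerivative.
Variable R : comNzRingType.

Definition xvar : {mpoly R[2]} := 'X_(0 : 'I_2).
Definition yvar : {mpoly R[2]} := 'X_(1 : 'I_2).

Definition is_formal_derivative
    (D : {linear {mpoly R[2]} -> {mpoly R[2]}}) : Prop :=
  [/\ forall u v, D (u * v) = D u * v + u * D v, D xvar = 1 & D yvar = 1].

Definition xyD (D : {mpoly R[2]} -> {mpoly R[2]}) (f : {mpoly R[2]}) :=
  xvar * yvar * D f.

(* The hypothesis on D is satisfiable: d/dx + d/dy. *)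
Lemma is_formal_derivative_exists :
  exists D : {linear {mpoly R[2]} -> {mpoly R[2]}}, is_formal_derivative D.
Proof.
pose D : {linear {mpoly R[2]} -> {mpoly R[2]}} :=
  mderiv (0 : 'I_2) \+ mderiv (1 : 'I_2).
exists D; split=> [u v||] /=.
- by rewrite !mderivM mulrDl mulrDr addrACA.
- by rewrite /xvar !mderivX !mnm1E eqxx -{1}[U_(_)%MM]add0m addmK mpolyX0
    scale1r scale0r addr0.
- by rewrite /yvar !mderivX !mnm1E eqxx -{2}[U_(_)%MM]add0m addmK mpolyX0
    scale1r scale0r add0r.
Qed.

End FormalDerivative.

(* Leaves are unlabelled, and an internal vertex [Node l a r] carries the
   label [a] and has left child [l] and right child [r]. *)
Inductive bintree : Type :=
| Leaf
| Node of bintree & nat & bintree.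

Section BintreeChoice.

Fixpoint bintree_encode (t : bintree) : GenTree.tree nat :=
  match t with
  | Leaf => GenTree.Node 0 [::]
  | Node l a r =>
      GenTree.Node 0 [:: bintree_encode l; GenTree.Leaf a; bintree_encode r]
  end.

Fixpoint bintree_decode (t : GenTree.tree nat) : bintree :=
  match t with
  | GenTree.Node _ [:: l; GenTree.Leaf a; r] =>
      Node (bintree_decode l) a (bintree_decode r)
  | _ => Leaf
  end.

Lemma bintree_encodeK : cancel bintree_encode bintree_decode.
Proof. by elim=> //= l -> a r ->. Qed.

End BintreeChoice.

HB.instance Definition _ := Countable.copy bintree (can_type bintree_encodeK).

Fixpoint labels (t : bintree) : seq nat :=
  if t is Node l a r then labels l ++ a :: labels r else [::].

(* The label sequences read along the paths from the root to each internal
   vertex. *)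
Fixpoint root_paths (t : bintree) : seq (seq nat) :=
  if t is Node l a r
  then [:: a] :: [seq a :: p | p <- root_paths l ++ root_paths r]
  else [::].

Definition root_label (t : bintree) : option nat :=
  if t is Node _ a _ then Some a else None.

(* [t] is a planted full binary increasing plane tree on its own label set. *)
Definition planted_increasing (t : bintree) : bool :=
  [&& uniq (labels t),
      (if root_label t is Some a then all (leq a) (labels t) else false)
    & all (sorted ltn) (root_paths t)].

Fixpoint left_leaves (t : bintree) : nat :=
  if t is Node l _ r
  then ((if l is Leaf then 1 else 0) + left_leaves l + left_leaves r)%N
  else 0%N.

(* That the label sets of the trees partition [n] is expressed by the
   concatenation of the (duplicate-free) label lists being a rearrangement of
   1, ..., n; the label sets are nonempty because every tree has a labelled
   root. *)
Definition binary_forest (n k : nat) (F : seq bintree) : bool :=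
  [&& size F == k,
      all planted_increasing F,
      perm_eq (flatten (map labels F)) (iota 1 n)
    & sorted ltn (pmap root_label F)].

Definition forest_left_leaves (F : seq bintree) : nat :=
  (\sum_(t <- F) left_leaves t)%N.

(* [c] is the number of k-forests on [n] with l left leaves. *)
Definition counts_forests (n k l c : nat) : Prop :=
  exists A : {fset (seq bintree)},
    (forall F,
       (F \in A) = binary_forest n k F && (forest_left_leaves F == l))
    /\ #|` A| = c.

(* Main.v *)
Require Import Defs.
From mathcomp Require Import all_boot all_order all_algebra.
From mathcomp Require Import finmap mpoly zify.

Set Implicit Arguments.
Unset Strict Implicit.
Unset Printing Implicit Defensive.

Import Order.TTheory GRing.Theory Num.Theory.
Local Open Scope ring_scope.

(** Both families of coefficients come from the same mechanism.  Suppose that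
    the elements [B n k l] of the polynomial ring satisfy
      x y D(B n k l) = l B(n+1,k,l) + w(n,k,l+1) B(n+1,k,l+1)
    and x y B(n,k,l) = B(n+1,k+1,l+1).  Applying x y D once to
    c B(n,k,l) D^k f and using the Leibniz rule then produces three terms, and
    collecting equal terms gives the recurrence
      c(n+1,k,l) = l c(n,k,l) + w(n,k,l) c(n,k,l-1) + c(n,k-1,l-1).
    For the monomials x^l y^(n+k-l) the weight is w = n + k - l + 1; for the
    products (xy)^l (x+y)^(n+k-2l) it is w = 2(n + k - 2l + 2), because
    D(xy) = x + y and D(x+y) = 2.  The array [coef w] is defined by this
    recurrence and [xyD_expansion] is the resulting identity; the summation
    ranges come from the support lemmas [coef_support] and
    [coef_gamma_support].

    For the combinatorial meaning, a forest on [n+1] arises in exactly one way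
    from a forest on [n]: the largest label n+1 either replaces a leaf by an
    internal vertex with two leaves, or forms a new last tree with one vertex.
    Replacing a left leaf keeps the number of left leaves, replacing a right
    leaf raises it by one, and a k-forest on [n] has n + k leaves; so a
    k-forest with l left leaves has l children with the same statistics, n+k-l
    with one more left leaf, and one with one more tree and one more left leaf.
    Read for a given shape of the enlarged forest, this is the recurrence for
    the first weight ([sum_extend], [coef_leaf_count]).  The generation is
    exhaustive and free of repetitions because deleting n+1 is inverse to
    inserting it ([extendP]). *)

(** * Coefficient arrays given by a three-term recurrence *)

Section Coefficients.
Variable w : nat -> int -> int -> int.
Hypothesis w0 : w 0 0 1 = 0.

(** The recursion starts at 0, where the identity operator has the single
    coefficient 1; with [w 0 0 1 = 0] the row 1 then has the single entry 1 at
    [(1, 1)], see [coef1]. *)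
Fixpoint coef (n : nat) (k l : int) : int :=
  if n is m.+1 then
    l * coef m k l + w m k l * coef m k (l - 1) + coef m (k - 1) (l - 1)
  else ((k == 0) && (l == 0))%:R.

Lemma coef1 k l : coef 1 k l = ((k == 1) && (l == 1))%:R.
Proof.
rewrite /= !subr_eq0.
have [->|k0] := eqVneq k 0; last by rewrite !mulr0 !add0r.
have [->|l0] := eqVneq l 0; first by rewrite mul0r mulr0 !add0r.
by have [->|l1] := eqVneq l 1; rewrite ?w0 ?mul0r !mulr0 !add0r.
Qed.

Lemma coef_support n k l : (0 < n)%N ->
  ~~ [&& 1 <= k, k <= n%:Z, k <= l & l <= n%:Z] -> coef n k l = 0.
Proof.
case: n => // n _; elim: n k l => [|n IH] k l out.
  by rewrite coef1; case: andP => // -[/eqP ek /eqP el]; rewrite ek el in out.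
have [o1 [o2 o3]] :
    ~~ [&& 1 <= k, k <= n.+1%:Z, k <= l & l <= n.+1%:Z]
    /\ ~~ [&& 1 <= k, k <= n.+1%:Z, k <= l - 1 & l - 1 <= n.+1%:Z]
    /\ ~~ [&& 1 <= k - 1, k - 1 <= n.+1%:Z, k - 1 <= l - 1
            & l - 1 <= n.+1%:Z] by lia.
change (l * coef n.+1 k l + w n.+1 k l * coef n.+1 k (l - 1)
        + coef n.+1 (k - 1) (l - 1) = 0).
by rewrite !IH // !mulr0 !add0r.
Qed.

(** The expansion of the operator is proved by induction from the row 0, whose
    entry at [(0, 0)] lies outside the sharper support. *)
Lemma coef_support0 n k l :
  ~~ [&& 0 <= k, k <= n%:Z, 0 <= l & l <= n%:Z] -> coef n k l = 0.
Proof.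
case: n => [|n] out; last by apply: coef_support => //; lia.
by rewrite /=; case: andP => // -[/eqP ek /eqP el]; rewrite ek el in out.
Qed.

End Coefficients.

(** [n + k - (l - 1)] is the number of right leaves of a k-forest on [n] that
    has [l - 1] left leaves. *)
Definition leaf_weight (n : nat) (k l : int) : int := n%:Z + k - l + 1.
(** The factor 2 is the derivative of [x + y], and [n + k - 2 * (l - 1)] is the
    exponent of [x + y] that accompanies [(x * y) ^+ (l - 1)]. *)
Definition gamma_weight (n : nat) (k l : int) : int :=
  2 * (n%:Z + k - 2 * l + 2).

Lemma leaf_weight0 : leaf_weight 0 0 1 = 0. Proof. by []. Qed.
Lemma gamma_weight0 : gamma_weight 0 0 1 = 0. Proof. by []. Qed.

(** The weight vanishes exactly where the recurrence would carry a coefficient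
    across the line [2 * l = n + k], so this line is never crossed. *)
Lemma coef_gamma_support n k l : (0 < n)%N ->
  ~~ [&& 1 <= k, k <= n%:Z, k <= l & l <= ((n%:Z + k) %/ 2)%Z] ->
  coef gamma_weight n k l = 0.
Proof.
move=> n0 out.
have [k_le|] := boolP [&& 1 <= k, k <= n%:Z, k <= l & l <= n%:Z]; last first.
  by apply: coef_support.
have {out k_le} : n%:Z + k < 2 * l by lia.
case: n n0 => // n _; elim: n k l => [|n IH] k l out.
  by rewrite coef1 //; case: andP => // -[/eqP ek /eqP el]; rewrite ek el in out.
change (l * coef gamma_weight n.+1 k l
        + gamma_weight n.+1 k l * coef gamma_weight n.+1 k (l - 1)
        + coef gamma_weight n.+1 (k - 1) (l - 1) = 0).
rewrite !(IH k l, IH (k - 1)) ?mulr0 ?add0r ?addr0; try by lia.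
have [o|e] := boolP (n.+1%:Z + k < 2 * (l - 1)).
  by rewrite IH ?mulr0.
have -> : gamma_weight n.+1 k l = 0 by rewrite /gamma_weight; lia.
by rewrite mul0r.
Qed.

(** * Operator expansions *)

Lemma intS_pred (i : nat) : i.+1%:Z - 1 = i%:Z.
Proof. by rewrite intS addrC addKr. Qed.

(** Reindexing for the shifts [k - 1] and [l - 1] of the recurrence. *)
Lemma sum_nat_shift (V : nmodType) (h h' : nat -> V) N :
    h' 0 = 0 -> h N = 0 -> (forall i, h' i.+1 = h i) ->
  \sum_(i < N.+1) h i = \sum_(i < N.+1) h' i.
Proof.
move=> h'0 hN hS; rewrite big_ord_recr big_ord_recl /= hN h'0 addr0 add0r.
by apply: eq_bigr => i _; rewrite hS.
Qed.

Lemma big_nat_support (V : nmodType) (h : nat -> V) m p N :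
    (p <= N)%N -> (forall i, ~~ (m <= i < p)%N -> h i = 0) ->
  \sum_(i < N) h i = \sum_(m <= i < p) h i.
Proof.
move=> pN h0; rewrite (big_nat_widenl _ 0) // (big_nat_widen _ _ N) //.
rewrite big_mkcond big_mkord; apply: eq_bigr => i _ /=.
by case: ifP => // /negbT; apply: h0.
Qed.

Section Expansion.
Variables (R : comNzRingType) (D : {linear {mpoly R[2]} -> {mpoly R[2]}}).
Hypothesis hD : is_formal_derivative D.

Lemma derivM u v : D (u * v) = D u * v + u * D v.
Proof. by case: hD. Qed.

Lemma deriv_intl (z : int) u : D (z%:~R * u) = z%:~R * D u.
Proof. by rewrite !mulrzl (raddfMz D). Qed.

Lemma deriv1 : D 1 = 0.
Proof.
by apply: (addIr (D 1)); rewrite add0r -{3}[1]mulr1 derivM mulr1 mul1r.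
Qed.

Lemma derivX u n : D (u ^+ n) = (u ^+ n.-1 * D u) *+ n.
Proof.
elim: n => [|n IH]; first by rewrite deriv1.
rewrite exprS derivM IH /= mulrS mulrC; congr (_ + _).
by case: n {IH} => [|n]; rewrite ?mulr0n ?mulr0 // mulrnAr mulrA -exprS.
Qed.

(** Multiplying by [u] avoids the predecessor in the exponent. *)
Lemma mul_derivX u n : u * D (u ^+ n) = (u ^+ n * D u) *+ n.
Proof.
case: n => [|n]; first by rewrite deriv1 mulr0 mulr0n.
by rewrite derivX mulrnAr mulrA -exprS.
Qed.

Section Basis.
Variable w : nat -> int -> int -> int.
Hypothesis w0 : w 0 0 1 = 0.
Variable B : nat -> nat -> nat -> {mpoly R[2]}.
Hypothesis B0 : B 0 0 0 = 1.
Hypothesis B_shift : forall n k l, (k <= n)%N -> (l <= n)%N ->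
  xvar R * yvar R * B n k l = B n.+1 k.+1 l.+1.
Hypothesis B_deriv : forall n k l : nat, coef w n k l != 0 ->
  xyD D (B n k l)
    = (l%:Z)%:~R * B n.+1 k l + (w n k (l%:Z + 1))%:~R * B n.+1 k l.+1.

(** Where the coefficient vanishes, both sides do; elsewhere the indices lie in
    the range where the hypotheses on [B] apply. *)
Lemma xyD_term n (k l : nat) g :
  xyD D ((coef w n k l)%:~R * B n k l * g)
  = (l%:Z * coef w n k l)%:~R * B n.+1 k l * g
    + (w n k (l%:Z + 1) * coef w n k l)%:~R * B n.+1 k l.+1 * g
    + (coef w n k l)%:~R * B n.+1 k.+1 l.+1 * D g.
Proof.
have [->|c0] := eqVneq (coef w n k l) 0.
  by rewrite !mulr0 !mul0r /xyD linear0 mulr0 !addr0.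
have reg : [&& 0 <= k%:Z, k%:Z <= n%:Z, 0 <= l%:Z & l%:Z <= n%:Z].
  by apply: contraNT c0 => /(coef_support0 w0) ->.
rewrite -B_shift; [|by lia|by lia].
have -> : xyD D ((coef w n k l)%:~R * B n k l * g) =
  (coef w n k l)%:~R * (xyD D (B n k l) * g + xvar R * yvar R * B n k l * D g).
  by rewrite /xyD -[_%:~R * _ * g]mulrA deriv_intl derivM mulrCA mulrDr !mulrA.
rewrite B_deriv // [l%:Z * _]mulrC [w n k _ * _]mulrC !intrM.
by rewrite mulrDl !mulrDr !mulrA.
Qed.

(** The square of side [N.+1] stays fixed during the induction on [n]: as long
    as [n < N], [coef w n] is zero where an index equals [N], so shifting an
    index by one loses no term. *)
Lemma xyD_expansion N n f : (n <= N)%N ->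
  iter n (xyD D) f
  = \sum_(k < N.+1) \sum_(l < N.+1)
      (coef w n k%:Z l%:Z)%:~R * B n k l * iter k D f.
Proof.
elim: n => [|n IH] nN.
  rewrite big_ord_recl big_ord_recl /= B0 !mul1r.
  rewrite [X in _ + X + _]big1 => [|i _]; last by rewrite !mul0r.
  rewrite big1 ?addr0 // => i _.
  by rewrite big1 // => j _; rewrite !mul0r.
have c_out k l : ~~ [&& 0 <= k, k <= n%:Z, 0 <= l & l <= n%:Z] ->
  coef w n k l = 0 by exact: coef_support0.
rewrite iterS IH ?(ltnW nN) //.
transitivity (\sum_(k < N.+1) (\sum_(l < N.+1)
     (l%:Z * coef w n k l)%:~R * B n.+1 k l * iter k D f
   + \sum_(l < N.+1) (w n k (l%:Z + 1) * coef w n k l)%:~R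
       * B n.+1 k l.+1 * iter k D f)
   + \sum_(k < N.+1) \sum_(l < N.+1)
       (coef w n k l)%:~R * B n.+1 k.+1 l.+1 * iter k.+1 D f).
  rewrite {1}/xyD raddf_sum mulr_sumr -big_split; apply: eq_bigr => k _ /=.
  rewrite raddf_sum mulr_sumr -!big_split; apply: eq_bigr => l _ /=.
  exact: xyD_term.
(* The terms that raise the order of [D] are shifted in both [k] and [l]. *)
rewrite [X in _ + X](@sum_nat_shift _
    (fun k => \sum_(l < N.+1)
       (coef w n k l)%:~R * B n.+1 k.+1 l.+1 * iter k.+1 D f)
    (fun k => \sum_(l < N.+1)
       (coef w n (k%:Z - 1) (l%:Z - 1))%:~R * B n.+1 k l * iter k D f));
  first last.
- move=> k; rewrite (@sum_nat_shift _
    (fun l => (coef w n k l)%:~R * B n.+1 k.+1 l.+1 * iter k.+1 D f)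
    (fun l => (coef w n (k.+1%:Z - 1) (l%:Z - 1))%:~R
                * B n.+1 k.+1 l * iter k.+1 D f)) //.
  + by rewrite c_out ?mul0r //; lia.
  + by rewrite c_out ?mul0r //; lia.
  + by move=> l; rewrite !intS_pred.
- by rewrite big1 // => l _; rewrite c_out ?mul0r //; lia.
- by rewrite big1 // => l _; rewrite c_out ?mul0r //; lia.
rewrite -big_split; apply: eq_bigr => k _ /=.
(* The remaining ones with index [l.+1] are shifted in [l] only. *)
rewrite [X in _ + X + _](@sum_nat_shift _
    (fun l => (w n k (l%:Z + 1) * coef w n k l)%:~R
       * B n.+1 k l.+1 * iter k D f)
    (fun l => (w n k l * coef w n k (l%:Z - 1))%:~R
       * B n.+1 k l * iter k D f)); first last.
- by move=> l; rewrite intS_pred intS addrC.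
- by rewrite c_out ?mulr0 ?mul0r //; lia.
- by rewrite c_out ?mulr0 ?mul0r //; lia.
rewrite -!big_split; apply: eq_bigr => l _ /=.
by rewrite -!mulrDl -!rmorphD.
Qed.

Lemma xyD_expansion_support n (U : nat -> nat) f :
    (forall k, (k <= n)%N -> (U k <= n.+1)%N) ->
    (forall k l : nat, ~~ [&& 1 <= k, k <= n, k <= l & l < U k]%N ->
       coef w n k l = 0) ->
  iter n (xyD D) f
  = \sum_(1 <= k < n.+1) \sum_(k <= l < U k)
      (coef w n k l)%:~R * B n k l * iter k D f.
Proof.
move=> U_le c0; rewrite (xyD_expansion f (leqnn n)).
pose T k l := (coef w n k%:Z l%:Z)%:~R * B n k l * iter k D f.
rewrite (@big_nat_support _ (fun k => \sum_(l < n.+1) T k l) 1 n.+1) //.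
  apply: eq_big_nat => k /andP[k1 kn].
  apply: (@big_nat_support _ (T k)) => [|l out]; first exact: U_le.
  by rewrite /T c0 ?mul0r // k1 -ltnS kn.
move=> k out; rewrite big1 // => l _.
rewrite /T c0 ?mul0r //; apply: contraNN out => /and3P[-> kn _].
by rewrite ltnS.
Qed.

End Basis.

Lemma xyD_monomial n k l : (l <= n + k)%N ->
  xyD D (xvar R ^+ l * yvar R ^+ (n + k - l))
  = (l%:Z)%:~R * (xvar R ^+ l * yvar R ^+ (n.+1 + k - l))
    + (leaf_weight n k (l%:Z + 1))%:~R
       * (xvar R ^+ l.+1 * yvar R ^+ (n.+1 + k - l.+1)).
Proof.
have [_ Dx Dy] := hD.
move=> ln; have -> : leaf_weight n k (l%:Z + 1) = (n + k - l)%N.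
  by rewrite /leaf_weight; lia.
rewrite addSn subSS subSn //; move: (n + k - l)%N => m.
rewrite /xyD derivM mulrDr [_ * (D _ * _)]mulrACA [_ * (_ * D _)]mulrACA.
rewrite !mul_derivX Dx Dy !mulr1 -!exprS.
by rewrite !mulrzl !pmulrn mulrnAl mulrnAr.
Qed.

(** When [2 * l = n + k] the weight is zero, so the truncated exponent of the
    second term is harmless. *)
Lemma xyD_gamma_monomial n k l : (2 * l <= n + k)%N ->
  xyD D ((xvar R * yvar R) ^+ l * (xvar R + yvar R) ^+ (n + k - 2 * l))
  = (l%:Z)%:~R
      * ((xvar R * yvar R) ^+ l * (xvar R + yvar R) ^+ (n.+1 + k - 2 * l))
    + (gamma_weight n k (l%:Z + 1))%:~R
       * ((xvar R * yvar R) ^+ l.+1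
          * (xvar R + yvar R) ^+ (n.+1 + k - 2 * l.+1)).
Proof.
have [_ Dx Dy] := hD.
move=> ln; have -> : gamma_weight n k (l%:Z + 1) = (2 * (n + k - 2 * l))%N.
  by rewrite /gamma_weight; lia.
have -> : (n.+1 + k - 2 * l.+1 = (n + k - 2 * l).-1)%N by lia.
rewrite addSn subSn //; move: (n + k - 2 * l)%N => m.
have Dxy : D (xvar R * yvar R) = xvar R + yvar R.
  by rewrite derivM Dx Dy mul1r mulr1 addrC.
have Ds : D (xvar R + yvar R) = 2%:R by rewrite linearD /= Dx Dy.
rewrite /xyD derivM mulrDr mulrA mul_derivX Dxy mulrA -exprS.
rewrite derivX Ds !mulrzl -!pmulrn mulrnAl -mulrA -exprS; congr (_ + _).
by rewrite mulr_natr -mulrnA mulrnAr.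
Qed.

Lemma leaf_expansion n f : (0 < n)%N ->
  iter n (xyD D) f =
    \sum_(1 <= k < n.+1) \sum_(k <= l < n.+1)
      (coef leaf_weight n k%:Z l%:Z)%:~R
        * (xvar R ^+ l * yvar R ^+ (n + k - l)) * iter k D f.
Proof.
move=> n0.
apply: (@xyD_expansion_support _ leaf_weight0
  (fun n k l => xvar R ^+ l * yvar R ^+ (n + k - l)) _ _ _ n (fun=> n.+1)) => //.
- by rewrite mulr1.
- move=> {n n0}n k l kn ln; rewrite mulrACA -!exprS; congr (_ * _ ^+ _); lia.
- move=> {n n0}n k l; have [ln _|ln] := leqP l (n + k).
    exact: xyD_monomial.
  by rewrite coef_support0 ?leaf_weight0 ?eqxx //; lia.
- by move=> k l out; rewrite coef_support //; lia.
Qed.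

Lemma gamma_expansion n f : (0 < n)%N ->
  iter n (xyD D) f =
    \sum_(1 <= k < n.+1) \sum_(k <= l < ((n + k) %/ 2).+1)
      (coef gamma_weight n k%:Z l%:Z)%:~R
        * ((xvar R * yvar R) ^+ l * (xvar R + yvar R) ^+ (n + k - 2 * l))
        * iter k D f.
Proof.
move=> n0.
apply: (@xyD_expansion_support _ gamma_weight0
  (fun n k l => (xvar R * yvar R) ^+ l * (xvar R + yvar R) ^+ (n + k - 2 * l))
  _ _ _ n (fun k => ((n + k) %/ 2).+1)) => //.
- by rewrite mulr1.
- by move=> {n n0}n k l kn ln; rewrite mulrA -exprS; congr (_ * _ ^+ _); lia.
- move=> {n n0}n k l; have [ln _|ln] := leqP (2 * l) (n + k).
    exact: xyD_gamma_monomial.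
  case: n ln => [|n] ln; last by rewrite coef_gamma_support ?eqxx //; lia.
  by rewrite coef_support0 ?eqxx //; lia.
- by move=> k kn; lia.
- by move=> k l out; rewrite coef_gamma_support //; lia.
Qed.

End Expansion.

(** * Grafting and pruning a largest label *)

Section Trees.
Local Open Scope nat_scope.

(** The number of leaves of [t] on side [s] ([true] for left) when [t] itself
    hangs on side [b].  The parameter [b] decides the side of a bare leaf, which
    makes the statistic additive over the two subtrees; a tree standing alone is
    given [b = false], as its root is not a left child. *)
Fixpoint leaf_count (s b : bool) (t : bintree) : nat :=
  if t is Node l _ r then leaf_count s true l + leaf_count s false r
  else s == b.

Definition is_node (t : bintree) : bool := if t is Leaf then false else true.

Fixpoint heap (t : bintree) : bool :=
  if t is Node l a r then
    [&& all (ltn a) (labels l), all (ltn a) (labels r), heap l & heap r]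
  else true.

Fixpoint graft (x : nat) (t : bintree) : seq bintree :=
  if t is Node l a r then
    [seq Node l' a r | l' <- graft x l] ++ [seq Node l a r' | r' <- graft x r]
  else [:: Node Leaf x Leaf].

(** The whole subtree below [x] is cut: in the intended use [x] is the largest
    label, so this subtree consists of two leaves. *)
Fixpoint prune (x : nat) (t : bintree) : bintree :=
  if t is Node l a r then
    if a == x then Leaf else Node (prune x l) a (prune x r)
  else Leaf.

Lemma left_leavesE t : left_leaves t = leaf_count true false t.
Proof.
elim: t => //= l -> a r ->; congr (_ + _).
by case: l.
Qed.

Lemma leaf_count_total b t :
  leaf_count true b t + leaf_count false b t = (size (labels t)).+1.
Proof.
elim: t b => [|l IHl a r IHr] b /=; first by case: b.
by rewrite size_cat /= addnACA IHl IHr addSn addnS.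
Qed.

(** The local order condition of [heap] and the global one on paths differ by
    transitivity; the bound [a] from above makes the induction go through. *)
Lemma path_root_paths a t :
  all (path ltn a) (root_paths t) = all (ltn a) (labels t) && heap t.
Proof.
elim: t a => //= l IHl b r IHr a.
rewrite andbT all_cat /= all_map.
have [ab|] := boolP (a < b); last by rewrite /= andbF.
rewrite (@eq_all _ _ (path ltn b)) => [|p] /=; last by rewrite ab.
rewrite all_cat IHl IHr.
have le c : all (ltn b) (labels c) -> all (ltn a) (labels c).
  by apply: sub_all => i; apply: ltn_trans.
case: (boolP (all (ltn b) (labels l))) => [/le->|]; last by rewrite /= !andbF.
by case: (boolP (all (ltn b) (labels r))) => [/le->|]; rewrite /= ?andbF.
Qed.

(** The root carries the smallest label because every path starts there and
    increases, so this condition disappears from the characterization. *)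
Lemma planted_increasingE t :
  planted_increasing t = [&& uniq (labels t), is_node t & heap t].
Proof.
rewrite /planted_increasing; case: t => //= l a r; congr (_ && _).
rewrite all_map (@eq_all _ _ (path ltn a)) // !all_cat !path_root_paths /=.
have le c : all (ltn a) (labels c) -> all (leq a) (labels c).
  by apply: sub_all => i; apply: ltnW.
rewrite leqnn /=.
case: (boolP (all (ltn a) (labels l))) => [/le->|]; last by rewrite /= !andbF.
by case: (boolP (all (ltn a) (labels r))) => [/le->|]; rewrite ?andbF.
Qed.

Lemma graft_labels x t u : u \in graft x t ->
  perm_eq (labels u) (x :: labels t).
Proof.
elim: t u => [|l IHl a r IHr] u; first by rewrite inE => /eqP->.
rewrite mem_cat => /orP[]/mapP[v v_in ->] /=.
  by rewrite -cat_cons perm_cat2r IHl.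
apply/permP => p; have /permP/(_ p) := IHr _ v_in.
by rewrite /= !count_cat /= => ->; lia.
Qed.

Lemma graft_root x t u : is_node t -> u \in graft x t ->
  root_label u = root_label t.
Proof.
by case: t => // l a r _; rewrite mem_cat => /orP[]/mapP[v _ ->].
Qed.

Lemma graft_node x t u : u \in graft x t -> is_node u.
Proof. by move=> /graft_labels/perm_size; case: u. Qed.

Lemma graft_heap x t u : all (gtn x) (labels t) -> heap t ->
  u \in graft x t -> heap u.
Proof.
elim: t u => [|l IHl a r IHr] u; first by move=> _ _; rewrite inE => /eqP->.
rewrite /= all_cat /= => /and3P[lx ax rx] /and4P[al ar hl hr].
rewrite mem_cat => /orP[]/mapP[v v_in ->] /=.
  by rewrite (perm_all _ (graft_labels v_in)) /= ax al ar hr IHl.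
by rewrite (perm_all _ (graft_labels v_in)) /= ax al ar hl IHr.
Qed.

Lemma prune_notin x t : x \notin labels t -> prune x t = t.
Proof.
elim: t => //= l IHl a r IHr.
rewrite mem_cat inE !negb_or => /and3P[/IHl-> + /IHr->].
by rewrite eq_sym => /negPf->.
Qed.

Lemma prune_graft x t u : x \notin labels t -> u \in graft x t ->
  prune x u = t.
Proof.
elim: t u => [|l IHl a r IHr] u.
  by move=> _; rewrite inE => /eqP-> /=; rewrite eqxx.
rewrite mem_cat inE !negb_or => /and3P[xl xa xr].
rewrite mem_cat => /orP[]/mapP[v v_in ->] /=; rewrite eq_sym (negPf xa).
  by rewrite (IHl v) // (prune_notin xr).
by rewrite (IHr v) // (prune_notin xl).
Qed.

Lemma graft_uniq x t : x \notin labels t -> uniq (graft x t).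
Proof.
elim: t => //= l IHl a r IHr.
rewrite mem_cat inE !negb_or => /and3P[xl _ xr].
rewrite cat_uniq !map_inj_uniq ?IHl ?IHr //; [|by move=> ? ? []..].
rewrite andbT /=; apply/hasPn => _ /mapP[v _ ->].
apply/mapP => -[v' v'_in [lv _]]; move: xl.
by rewrite lv (perm_mem (graft_labels v'_in)) mem_head.
Qed.

(** Shows that the children of the largest label are leaves. *)
Lemma labels_above_max x t :
  all (ltn x) (labels t) -> all (geq x) (labels t) -> t = Leaf.
Proof.
case: t => //= l a r; rewrite !all_cat /= => /and3P[_ xa _] /and3P[_ ax _].
by move: xa ax => /=; rewrite ltnNge => /negPf->.
Qed.

Lemma prune_labels x t : heap t -> all (geq x) (labels t) ->
  labels (prune x t) = [seq i <- labels t | i != x].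
Proof.
elim: t => //= l IHl a r IHr /and4P[al ar hl hr].
rewrite all_cat /= => /and3P[lx ax rx].
have [eax|ax'] := eqVneq a x.
  by move: al ar; rewrite eax => /labels_above_max-> // /labels_above_max-> //=;
    rewrite eqxx.
by rewrite filter_cat /= ax' IHl // IHr.
Qed.

Lemma prune_heap x t : heap t -> all (geq x) (labels t) -> heap (prune x t).
Proof.
elim: t => //= l IHl a r IHr /and4P[al ar hl hr].
rewrite all_cat /= => /and3P[lx ax rx].
case: ifP => //= _; rewrite !prune_labels // IHl // IHr // !andbT !all_filter.
by apply/andP; split; [move: al|move: ar]; apply: sub_all => i /= ->;
  rewrite implybT.
Qed.

Lemma graft_prune x t : heap t -> all (geq x) (labels t) -> uniq (labels t) ->
  x \in labels t -> t \in graft x (prune x t).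
Proof.
elim: t => //= l IHl a r IHr /and4P[al ar hl hr].
rewrite all_cat /= => /and3P[lx ax rx].
have [eax|ax'] := eqVneq a x.
  move: al ar; rewrite eax => /labels_above_max-> // /labels_above_max-> //=.
  by move=> _ _; rewrite inE eqxx.
rewrite cat_uniq /= negb_or => /and4P[ul /andP[al' dis] ar' ur].
rewrite mem_cat inE eq_sym (negPf ax') /= mem_cat.
case: (boolP (x \in labels l)) => [xl _|xl /= xr].
  have xr : x \notin labels r by apply: contraL xl => /(hasPn dis).
  by rewrite (prune_notin xr) map_f ?IHl.
by rewrite (prune_notin xl) [X in _ || X]map_f ?orbT ?IHr.
Qed.

(** Grafting replaces a leaf by a vertex with one left and one right leaf: at a
    left leaf the left count is kept, at a right leaf it grows by one.  Stating
    this with an arbitrary [f] encodes the whole distribution of the statistic,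
    and lets the induction absorb the leaves of the other subtree into [f]. *)
Lemma sum_graft (V : nmodType) (f : nat -> V) x b t :
  (\sum_(u <- graft x t) f (leaf_count true b u)
   = f (leaf_count true b t) *+ leaf_count true b t
     + f (leaf_count true b t).+1 *+ leaf_count false b t)%R.
Proof.
elim: t f b => [|l IHl a r IHr] f b /=.
  by rewrite big_seq1; case: b; rewrite /= ?mulr0n ?addr0 ?add0r.
rewrite big_cat !big_map /=.
rewrite (IHl (fun i => f (i + leaf_count true false r))).
rewrite (IHr (fun i => f (leaf_count true true l + i))).
by rewrite addnS addSn addrACA -!mulrnDr.
Qed.

End Trees.

(** * Generating the increasing forests *)

Section Forests.
Local Open Scope nat_scope.
Implicit Types (F H : seq bintree) (x n : nat).

Definition forest_labels F : seq nat := flatten (map labels F).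
Definition forest_roots F : seq nat := pmap root_label F.
Definition forest_right_leaves F : nat :=
  \sum_(t <- F) leaf_count false false t.
Definition heaps F : bool := all (fun t => is_node t && heap t) F.

Definition increasing_forest n F : bool :=
  [&& heaps F, perm_eq (forest_labels F) (iota 1 n)
    & sorted ltn (forest_roots F)].

(** That the labels within one tree are distinct is implied by the rearrangement
    condition on all labels. *)
Lemma binary_forestE n k F :
  binary_forest n k F = (size F == k) && increasing_forest n F.
Proof.
rewrite /binary_forest /increasing_forest; congr (_ && _).
rewrite !andbA; congr (_ && _).
case: (boolP (perm_eq _ _)) => [pF|]; last by rewrite !andbF.
have : uniq (forest_labels F) by rewrite (perm_uniq pF) iota_uniq.
rewrite !andbT /heaps {pF}; elim: F => //= t F IH.
rewrite /forest_labels /= cat_uniq => /and3P[ut _ /IH->].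
by rewrite planted_increasingE ut.
Qed.

Fixpoint forest_graft x F : seq (seq bintree) :=
  if F is t :: F' then
    [seq u :: F' | u <- graft x t] ++ [seq t :: H | H <- forest_graft x F']
  else [::].

Definition extend x F : seq (seq bintree) :=
  rcons F (Node Leaf x Leaf) :: forest_graft x F.

(** A tree whose root is [x] is pruned to a bare leaf, which must disappear from
    the forest. *)
Definition forest_prune x F : seq bintree :=
  [seq t <- map (prune x) F | is_node t].

Lemma forest_graft_size x F H : H \in forest_graft x F -> size H = size F.
Proof.
elim: F H => //= t F IH H; rewrite mem_cat => /orP[]/mapP[u u_in ->] //=.
by rewrite (IH u).
Qed.

Lemma forest_graft_labels x F H : H \in forest_graft x F ->
  perm_eq (forest_labels H) (x :: forest_labels F).
Proof.
elim: F H => //= t F IH H; rewrite mem_cat => /orP[]/mapP[u u_in ->].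
  by rewrite /forest_labels /= -cat_cons perm_cat2r graft_labels.
apply/permP => p; have /permP/(_ p) := IH _ u_in.
by rewrite /forest_labels /= !count_cat /= => ->; lia.
Qed.

Lemma forest_graft_roots x F H : heaps F -> H \in forest_graft x F ->
  forest_roots H = forest_roots F.
Proof.
elim: F H => //= t F IH H /andP[/andP[tL _] hF].
rewrite mem_cat => /orP[]/mapP[u u_in ->]; rewrite /forest_roots /=.
  by rewrite (graft_root tL u_in).
by rewrite -[pmap _ u]/(forest_roots u) (IH _ hF u_in).
Qed.

Lemma forest_graft_heaps x F H : all (gtn x) (forest_labels F) -> heaps F ->
  H \in forest_graft x F -> heaps H.
Proof.
elim: F H => //= t F IH H; rewrite /forest_labels /= all_cat.
move=> /andP[tx Fx] /andP[/andP[tL ht] hF].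
rewrite mem_cat => /orP[]/mapP[u u_in ->] /=.
  by rewrite (graft_node u_in) (graft_heap tx ht u_in).
by rewrite tL ht (IH u).
Qed.

Lemma forest_prune_notin x F : heaps F -> x \notin forest_labels F ->
  forest_prune x F = F.
Proof.
elim: F => //= t F IH /andP[/andP[tL _] hF].
rewrite /forest_labels /= mem_cat negb_or => /andP[xt xF].
by rewrite /forest_prune /= prune_notin // tL -/(forest_prune x F) IH.
Qed.

Lemma forest_prune_graft x F H : heaps F -> x \notin forest_labels F ->
  H \in forest_graft x F -> forest_prune x H = F.
Proof.
elim: F H => //= t F IH H /andP[/andP[tL ht] hF].
rewrite /forest_labels /= mem_cat negb_or => /andP[xt xF].
rewrite mem_cat => /orP[]/mapP[u u_in ->] /=; rewrite /forest_prune /=.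
  by rewrite (prune_graft xt u_in) tL -/(forest_prune x F) forest_prune_notin.
by rewrite prune_notin // tL -/(forest_prune x u) (IH u).
Qed.

Lemma forest_graft_uniq x F : x \notin forest_labels F ->
  uniq (forest_graft x F).
Proof.
elim: F => //= t F IH.
rewrite /forest_labels /= mem_cat negb_or => /andP[xt xF].
rewrite cat_uniq !map_inj_uniq ?IH ?graft_uniq //; [|by move=> ? ? []..].
rewrite andbT /=; apply/hasPn => _ /mapP[v _ ->].
apply/mapP => -[v' v'_in [tv _]]; move: xt.
by rewrite tv (perm_mem (graft_labels v'_in)) mem_head.
Qed.

Lemma forest_graft_prune x F : heaps F -> all (geq x) (forest_labels F) ->
    uniq (forest_labels F) -> x \in forest_labels F ->
    x \notin forest_roots F ->
  F \in forest_graft x (forest_prune x F).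
Proof.
elim: F => //= t F IH /andP[/andP[tL ht] hF].
rewrite /forest_labels /= all_cat cat_uniq mem_cat.
move=> /andP[tx Fx] /and3P[ut dis uF] xtF.
rewrite /forest_roots => xr.
have [nL xF] : is_node (prune x t) /\ x \notin forest_roots F.
  case: t tL xr {ht tx ut dis xtF} => //= l a r _.
  by rewrite inE negb_or eq_sym => /andP[/negPf-> ->].
rewrite /forest_prune /= nL -/(forest_prune x F) mem_cat.
have [xt|xt] := boolP (x \in labels t).
  have xnF : x \notin forest_labels F by apply: contraL xt => /(hasPn dis).
  by rewrite forest_prune_notin // map_f // graft_prune.
rewrite (negPf xt) in xtF.
by rewrite (prune_notin xt) [X in _ || X]map_f ?orbT // IH.
Qed.

Lemma forest_prune_labels x F : heaps F -> all (geq x) (forest_labels F) ->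
  forest_labels (forest_prune x F) = [seq i <- forest_labels F | i != x].
Proof.
elim: F => //= t F IH /andP[/andP[_ ht] hF].
rewrite /forest_labels /= all_cat filter_cat => /andP[tx Fx].
rewrite -prune_labels // -/(forest_labels F) -IH //.
by rewrite /forest_prune /=; case: (prune x t).
Qed.

Lemma forest_prune_roots x F :
  forest_roots (forest_prune x F) = [seq i <- forest_roots F | i != x].
Proof.
elim: F => //= -[|l a r] F IH; rewrite /forest_roots /forest_prune /=.
  exact: IH.
by case: eqVneq => _ /=; [exact: IH | congr (_ :: _); exact: IH].
Qed.

Lemma forest_prune_heaps x F : heaps F -> all (geq x) (forest_labels F) ->
  heaps (forest_prune x F).
Proof.
elim: F => //= t F IH /andP[/andP[_ ht] hF].
rewrite /forest_labels /= all_cat => /andP[tx Fx].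
rewrite /forest_prune /=; case: ifP => //= [-> /=|_]; last exact: IH.
by rewrite prune_heap // IH.
Qed.

Lemma forest_roots_sub F : {subset forest_roots F <= forest_labels F}.
Proof.
move=> i; elim: F => //= -[|l a r] F IH; rewrite /forest_roots /=.
  exact: IH.
rewrite inE /forest_labels /= mem_cat => /orP[/eqP->|/IH->]; last exact: orbT.
by rewrite mem_cat mem_head orbT.
Qed.

Lemma iota_rcons n : iota 1 n.+1 = rcons (iota 1 n) n.+1.
Proof. by have := iotaD 1 n 1; rewrite addn1 cats1 add1n. Qed.

(** Insertion and deletion of the largest label are mutually inverse.  For the
    converse, two cases: if n+1 is a root, it is the last root and its tree has
    one vertex; otherwise it hangs in place of a leaf of the pruned forest. *)
Lemma extendP n F H :
  (increasing_forest n F && (H \in extend n.+1 F))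
  = increasing_forest n.+1 H && (F == forest_prune n.+1 H).
Proof.
apply/andP/andP => [[/and3P[hF pF sF]]|].
  have bF : all (gtn n.+1) (forest_labels F).
    by rewrite (perm_all _ pF); apply/allP => i; rewrite mem_iota => /andP[].
  have nF : n.+1 \notin forest_labels F.
    by rewrite (perm_mem pF) mem_iota ltnn andbF.
  rewrite inE => /orP[/eqP->|Hin]; last first.
    rewrite (forest_prune_graft hF nF Hin) eqxx; split=> //.
    apply/and3P; split; first exact: forest_graft_heaps Hin.
      apply: perm_trans (forest_graft_labels Hin) _.
      by rewrite iota_rcons perm_sym perm_rcons perm_cons perm_sym.
    by rewrite (forest_graft_roots hF Hin).
  rewrite /increasing_forest iota_rcons /heaps all_rcons /= -/(heaps F) hF.
  rewrite /forest_labels /forest_roots /forest_prune map_rcons flatten_rcons.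
  rewrite -!cats1 pmap_cat /= perm_cat2r pF map_cat filter_cat.
  rewrite /= eqxx /= cats0 -/(forest_prune n.+1 F) forest_prune_notin // eqxx.
  split=> //; rewrite sorted_pairwise; last exact: ltn_trans.
  rewrite cats1 pairwise_rcons -sorted_pairwise ?sF ?andbT;
    last exact: ltn_trans.
  by apply/allP => i /forest_roots_sub/(allP bF).
move=> [/and3P[hH pH sH] /eqP->].
have bH : all (geq n.+1) (forest_labels H).
  rewrite (perm_all _ pH); apply/allP => i; rewrite mem_iota => /andP[_].
  by rewrite add1n ltnS.
have xH : n.+1 \in forest_labels H.
  by rewrite (perm_mem pH) mem_iota /= add1n ltnSn.
have uH : uniq (forest_labels H) by rewrite (perm_uniq pH) iota_uniq.
split.
  apply/and3P; split; first exact: forest_prune_heaps.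
    rewrite forest_prune_labels //.
    apply: perm_trans (perm_filter _ pH) _.
    rewrite iota_rcons -cats1 filter_cat /= eqxx cats0.
    rewrite (@eq_in_filter _ _ predT) ?filter_predT // => i.
    by rewrite mem_iota => /andP[_]; rewrite add1n ltn_neqAle => /andP[].
  rewrite forest_prune_roots; apply: sorted_filter => //; exact: ltn_trans.
(* It remains to find H among the insertions into its pruned forest. *)
rewrite inE; have [xr|xr] := boolP (n.+1 \in forest_roots H); last first.
  by rewrite forest_graft_prune ?orbT.
case/lastP: H => // H t in hH {pH} sH bH xH uH xr *.
have [{}hH tN ht] : [/\ heaps H, is_node t & heap t].
  by move: hH; rewrite /heaps all_rcons => /andP[/andP[]].
have : forest_labels (rcons H t) = forest_labels H ++ labels t.
  by rewrite /forest_labels map_rcons flatten_rcons.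
case: t tN ht => // l a r _ /= /and4P[al ar hl hr] in sH bH xH uH xr * => E.
have : forest_roots (rcons H (Node l a r)) = rcons (forest_roots H) a.
  by rewrite /forest_roots -!cats1 pmap_cat.
move=> Er; rewrite Er mem_rcons inE in xr.
rewrite E all_cat /= all_cat /= in bH.
case/and4P: bH => bH bl /= ba br.
have ea : a = n.+1.
  case/orP: xr => [/eqP //|xr].
  rewrite Er sorted_pairwise ?pairwise_rcons in sH; last exact: ltn_trans.
  by case/andP: sH => /allP/(_ _ xr) /=; rewrite ltnNge ba.
have lL : l = Leaf by apply: (@labels_above_max n.+1); rewrite // -ea.
have rL : r = Leaf by apply: (@labels_above_max n.+1); rewrite // -ea.
rewrite ea lL rL in E uH *.
have nH : n.+1 \notin forest_labels H.
  by move: uH; rewrite E cats1 rcons_uniq => /andP[].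
apply/orP; left; rewrite /forest_prune map_rcons filter_rcons /= eqxx /=.
by rewrite -/(forest_prune n.+1 H) forest_prune_notin.
Qed.

Lemma sum_forest_graft (V : nmodType) (f : nat -> V) x F :
  (\sum_(H <- forest_graft x F) f (forest_left_leaves H)
   = f (forest_left_leaves F) *+ forest_left_leaves F
     + f (forest_left_leaves F).+1 *+ forest_right_leaves F)%R.
Proof.
elim: F f => [|t F IH] f /=.
  by rewrite /forest_left_leaves /forest_right_leaves !big_nil !mulr0n addr0.
rewrite big_cat !big_map /=.
pose g c u := forest_left_leaves (u :: c).
have gE c u : forest_left_leaves (u :: c)
    = leaf_count true false u + forest_left_leaves c.
  by rewrite /forest_left_leaves big_cons left_leavesE.
under eq_bigr do rewrite gE.
under [in X in (_ + X)%R]eq_bigr do rewrite gE.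
rewrite (sum_graft (fun i => f (i + forest_left_leaves F))).
rewrite (IH (fun i => f (leaf_count true false t + i))).
rewrite gE /forest_right_leaves big_cons.
by rewrite addnS addSn addrACA -!mulrnDr.
Qed.

Lemma forest_leaves F :
  forest_left_leaves F + forest_right_leaves F
  = size (forest_labels F) + size F.
Proof.
rewrite /forest_left_leaves /forest_right_leaves -big_split /=.
elim: F => [|t F IH]; first by rewrite big_nil.
rewrite big_cons IH left_leavesE leaf_count_total /forest_labels /= size_cat.
lia.
Qed.

Fixpoint forests n : seq (seq bintree) :=
  if n is m.+1 then flatten [seq extend n F | F <- forests m] else [:: [::]].

Lemma mem_forests n F : (F \in forests n) = increasing_forest n F.
Proof.
elim: n F => [|n IH] F.
  rewrite inE; case: F => [|t F]; first by [].
  apply/esym/negP => /and3P[/= /andP[/andP[tN _] _] /perm_size].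
  by case: t tN => // l a r _; rewrite /forest_labels /= !size_cat /= addnS.
apply/flattenP/idP => [[_ /mapP[G G_in ->] F_in]|F_in].
  rewrite IH in G_in.
  by have := extendP n G F; rewrite G_in F_in => /esym/andP[].
have := extendP n (forest_prune n.+1 F) F.
rewrite F_in eqxx => /andP[G_in F_ex].
by exists (extend n.+1 (forest_prune n.+1 F)); rewrite // map_f ?IH.
Qed.

Lemma extend_uniq n F : increasing_forest n F -> uniq (extend n.+1 F).
Proof.
move=> /and3P[_ pF _]; rewrite /= forest_graft_uniq ?andbT.
  by apply/negP => /forest_graft_size/eqP; rewrite size_rcons gtn_eqF.
by rewrite (perm_mem pF) mem_iota ltnn andbF.
Qed.

(** Forests generated from different ones are told apart by pruning. *)
Lemma forests_uniq n : uniq (forests n).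
Proof.
elim: n => //= n IH.
have in_fiber G H : G \in forests n -> H \in extend n.+1 G ->
    G = forest_prune n.+1 H.
  rewrite mem_forests => iG Hin; have := extendP n G H.
  by rewrite iG Hin => /esym/andP[_ /eqP].
have : all (fun G => G \in forests n) (forests n) by apply/allP.
move: {1 3 4}(forests n) IH => s; elim: s => // G s IHs.
move=> /andP[Gs us] /andP[iG ins].
change (uniq (extend n.+1 G ++ flatten [seq extend n.+1 F | F <- s])).
rewrite cat_uniq IHs // andbT extend_uniq -?mem_forests //.
apply/hasPn => H /flattenP[_ /mapP[G' G's ->] H'_in].
apply/negP => H_in; move: Gs.
by rewrite (in_fiber _ _ iG H_in) -(in_fiber _ _ (allP ins _ G's) H'_in) G's.
Qed.

End Forests.

(** * Counting forests by left leaves *)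

Lemma sum_extend (V : nmodType) (f : nat -> nat -> V) x F :
  \sum_(H <- extend x F) f (size H) (forest_left_leaves H)
  = f (size F).+1 (forest_left_leaves F).+1
    + (f (size F) (forest_left_leaves F) *+ forest_left_leaves F
       + f (size F) (forest_left_leaves F).+1 *+ forest_right_leaves F).
Proof.
rewrite big_cons size_rcons; congr (f _ _ + _).
  by rewrite /forest_left_leaves -cats1 big_cat big_seq1 /= addn1.
rewrite -(sum_forest_graft (f (size F)) x) big_seq_cond [RHS]big_seq_cond.
by apply: eq_bigr => H /andP[/forest_graft_size-> _].
Qed.

Definition has_shape (k l : int) (F : seq bintree) : bool :=
  ((size F)%:Z == k) && ((forest_left_leaves F)%:Z == l).

(** Both sides satisfy the same recurrence: for each forest on [n], the three
    terms of [sum_extend] match the three terms of the recurrence. *)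
Lemma coef_leaf_count n k l :
  coef leaf_weight n k l = (count (has_shape k l) (forests n))%:Z.
Proof.
pose ind (k l : int) (i j : nat) : int := ((i%:Z == k) && (j%:Z == l))%:R.
have countE m i j : (count (has_shape i j) (forests m))%:Z
    = \sum_(F <- forests m) ind i j (size F) (forest_left_leaves F).
  rewrite -sum1_count -[LHS]natz natr_sum big_mkcond /=.
  by apply: eq_bigr => F _; rewrite /ind /has_shape; case: ifP.
rewrite countE; elim: n k l => [|n IH] k l.
  by rewrite big_seq1 /forest_left_leaves big_nil /ind /= ![0 == _]eq_sym.
(* Row [n.+1] of the forests, grouped according to the pruned forest. *)
rewrite [LHS]/= !IH !mulr_sumr -!big_split big_flatten big_map /=.
rewrite [LHS]big_seq_cond [RHS]big_seq_cond; apply: eq_bigr => F.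
rewrite andbT mem_forests => /and3P[_ /perm_size sz _].
rewrite sum_extend.
have := forest_leaves F; rewrite sz size_iota.
move: (size F) (forest_left_leaves F) (forest_right_leaves F) => i j r ijr.
have -> : ind k l i.+1 j.+1 = ind (k - 1) (l - 1) i j.
  by rewrite /ind; congr (_ %:R); congr nat_of_bool; lia.
have -> : ind k l i j.+1 = ind k (l - 1) i j.
  by rewrite /ind; congr (_ %:R); congr nat_of_bool; lia.
apply: esym; rewrite [LHS]addrC; congr (_ + _ + _); rewrite /ind /leaf_weight.
  have [_|_] := eqVneq i%:Z k; last by rewrite mul0rn mulr0.
  have [<-|_] := eqVneq j%:Z l; rewrite /= ?mul0rn ?mulr0 // mulr1.
  exact: natz.
have [<-|_] := eqVneq i%:Z k; last by rewrite mul0rn mulr0.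
have [ej|_] := eqVneq j%:Z (l - 1); rewrite /= ?mul0rn ?mulr0 //.
by rewrite mulr1 natz; lia.
Qed.

Theorem theorem22 (R : comNzRingType)
    (D : {linear {mpoly R[2]} -> {mpoly R[2]}})
    (hD : is_formal_derivative D) :
  (exists a : nat -> int -> int -> int,
    (forall (n : nat) (k l : int), (0 < n)%N ->
       ~~ [&& 1 <= k, k <= n%:Z, k <= l & l <= n%:Z] -> a n k l = 0)
    /\ a 1%N 1 1 = 1
    /\ (forall k l : int, (k, l) <> (1, 1) -> a 1%N k l = 0)
    /\ (forall (n : nat) (k l : int), (0 < n)%N ->
          a n.+1 k l = l * a n k l + (n%:Z + k - l + 1) * a n k (l - 1)
                       + a n (k - 1) (l - 1))
    /\ (forall (n : nat), (0 < n)%N -> forall f : {mpoly R[2]},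
          iter n (xyD D) f =
            \sum_(1 <= k < n.+1) \sum_(k <= l < n.+1)
              (a n k%:Z l%:Z)%:~R
                * (xvar R ^+ l * yvar R ^+ (n + k - l)) * iter k D f)
    /\ (forall n k l : nat, (0 < n)%N ->
          exists2 c : nat, counts_forests n k l c & a n k%:Z l%:Z = c%:Z))
  /\
  (exists g : nat -> int -> int -> int,
    (forall (n : nat) (k l : int), (0 < n)%N ->
       ~~ [&& 1 <= k, k <= n%:Z, k <= l & l <= ((n%:Z + k) %/ 2)%Z] ->
       g n k l = 0)
    /\ g 1%N 1 1 = 1
    /\ (forall k l : int, (k, l) <> (1, 1) -> g 1%N k l = 0)
    /\ (forall (n : nat) (k l : int), (0 < n)%N ->
          g n.+1 k l = l * g n k l
                       + 2 * (n%:Z + k - 2 * l + 2) * g n k (l - 1)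
                       + g n (k - 1) (l - 1))
    /\ (forall (n : nat), (0 < n)%N -> forall f : {mpoly R[2]},
          iter n (xyD D) f =
            \sum_(1 <= k < n.+1) \sum_(k <= l < ((n + k) %/ 2).+1)
              (g n k%:Z l%:Z)%:~R
                * ((xvar R * yvar R) ^+ l
                   * (xvar R + yvar R) ^+ (n + k - 2 * l)) * iter k D f)).
Proof.
split.
  exists (coef leaf_weight); split; first exact: coef_support leaf_weight0.
  split; first by rewrite coef1.
  split.
    by move=> k l kl; rewrite coef1 //; case: andP => // -[/eqP ek /eqP el];
      case: kl; rewrite ek el.
  split; first by [].
  split; first by move=> n n0 f; apply: leaf_expansion.
  move=> n k l n0; exists (count (has_shape k l) (forests n)); last first.
    exact: coef_leaf_count.
  exists [fset F in filter (has_shape k l) (forests n)]%fset; split.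
    move=> F; rewrite inE /= mem_filter mem_forests binary_forestE andbAC.
    by rewrite /has_shape !eqz_nat.
  by rewrite card_fseq undup_id ?filter_uniq ?forests_uniq // size_filter.
exists (coef gamma_weight); split; first exact: coef_gamma_support.
split; first by rewrite coef1.
split.
  by move=> k l kl; rewrite coef1 //; case: andP => // -[/eqP ek /eqP el];
    case: kl; rewrite ek el.
split; first by [].
by move=> n n0 f; apply: gamma_expansion.
Qed.
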